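(* Let $D$ be a set of sampled data, and let $\{\mathcal G_k\}$ be a collection of grids for $X$, partially ordered by refinement. For each $k$, let $\mathcal F^{\mathcal G_k}_D:\mathcal G_k\rightrightarrows\mathcal G_k$ be the multivalued map associated to $D$ on $\mathcal G_k$, and let $\mathfrak M^{\mathcal G_k}$ be the finest augmented Morse decomposition of $\mathcal F^{\mathcal G_k}_D$. Then for every $\mathcal G_{k_1}<\mathcal G_{k_2}$ there is an augmented Morse decomposition morphism $\mathfrak h_{\mathcal G_{k_1}}^{\mathcal G_{k_2}}:\mathfrak M^{\mathcal G_{k_1}}\to\mathfrak M^{\mathcal G_{k_2}}$ such that $\mathfrak h_{\mathcal G_{k_2}}^{\mathcal G_{k_3}}\circ\mathfrak h_{\mathcal G_{k_1}}^{\mathcal G_{k_2}}=\mathfrak h_{\mathcal G_{k_1}}^{\mathcal G_{k_3}}$ for any $\mathcal G_{k_1}<\mathcal G_{k_2}<\mathcal G_{k_3}$.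
   Context: Setting: $X$ is a compact metric space, $f:X\to X$ is continuous, and the sampled data are a finite set of pairs of points of $X$, $D=\{(x_i,y_i):y_i=f(x_i)\}_{i=1}^K$. A grid $\mathcal G$ on $X$ is a finite collection of nonempty compact subsets of $X$ such that (1) $X=\bigcup_{G\in\mathcal G}G$; (2) $G=\operatorname{cl}(\operatorname{int}(G))$ for all $G$; (3) $G\cap\operatorname{int}(H)=\emptyset$ for all $G\ne H$ in $\mathcal G$. $\mathcal G$ refines $\mathcal G'$, written $\mathcal G<\mathcal G'$, if every $G\in\mathcal G$ is contained in some $G'\in\mathcal G'$. The multivalued map associated to $D$ on $\mathcal G$ is $\mathcal F^{\mathcal G}_D(G)=\{H\in\mathcal G:$ there exists $(x_i,y_i)\in D$ with $x_i\in G$, $y_i\in H\}$, identified with the directed graph on $\mathcal G$ with an edge $G\to H$ whenever $H\in\mathcal F_D^{\mathcal G}(G)$; stranded vertices (those with no incoming or no outgoing edge) are trimmed from the graph (repeatedly), which does not affect the Morse decomposition. For a multivalued map $\mathcal F$, an orbit is a sequence $\{G_i\}$ with $G_{i+1}\in\mathcal F(G_i)$. The Morse sets $\mathcal S_j$ of the finest Morse decomposition are the nontrivial strongly connected components of the graph $\mathcal F$ (a single vertex with a loop counts as nontrivial), partially ordered by $\mathcal S_j\succeq\mathcal S_k$ iff there is an orbit from $\mathcal S_j$ to $\mathcal S_k$. The finest augmented Morse decomposition is $\mathfrak M=(\{\mathcal S_j\},\succeq,\{\mathcal F_j:\mathcal S_j\rightrightarrows\mathcal S_j\})$ with $\mathcal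 F_j(G)=\mathcal F(G)\cap\mathcal S_j$. A grid map morphism between multivalued maps $\mathcal F$ and $\mathcal F'$ is a single-valued map $h$ between the underlying sets with $h(\mathcal F(G))\subset\mathcal F'(h(G))$ for all $G$. An augmented Morse decomposition morphism $\mathfrak h:\mathfrak M^{\mathcal G}\to\mathfrak M^{\mathcal G'}$ is a pair $(\bar h,\{h_j\})$, where $\bar h:\{\mathcal S_j^{\mathcal G}\}\to\{\mathcal S_j^{\mathcal G'}\}$ satisfies $\bar h(\mathcal S^{\mathcal G}_j)\succeq^{\mathcal G'}\bar h(\mathcal S^{\mathcal G}_k)$ whenever $\mathcal S^{\mathcal G}_j\succeq^{\mathcal G}\mathcal S^{\mathcal G}_k$, and each $h_j:\mathcal S_j^{\mathcal G}\to\bar h(\mathcal S_j^{\mathcal G})$ is a grid map morphism for the induced restriction maps. Morphisms are composed componentwise. *)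

(* Defs.v *)
From HB Require Import structures.
From mathcomp Require Import all_boot all_order all_algebra.
From mathcomp Require Import all_classical all_reals all_analysis.

Set Implicit Arguments.
Unset Strict Implicit.
Unset Printing Implicit Defensive.

Local Open Scope classical_set_scope.

(* A multivalued map on [V] is also the directed graph on [V] with an edge
   G -> H whenever [F G H]. *)
Definition multimap (V : Type) : Type := V -> set V.

(* The map G |-> F(G) `&` A on the vertices in A. *)
Definition mm_restrict (V : Type) (F : multimap V) (A : set V) : multimap A :=
  fun G => [set H | F (val G) (val H)].
Arguments mm_restrict {V} F A.

Section Orbits.
Context (V : Type) (F : multimap V).

Definition is_orbit (n : nat) (g : nat -> V) : Prop :=
  forall i, (i < n)%N -> F (g i) (g i.+1).

(* Length 0 is allowed, so every vertex reaches itself. *)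
Definition orbit_from_to (G H : V) : Prop :=
  exists n g, [/\ is_orbit n g, g 0%N = G & g n = H].

Definition is_strong_component (S : set V) : Prop :=
  exists G, S = [set H | orbit_from_to G H /\ orbit_from_to H G].

(* A single vertex is a nontrivial component only if it carries a loop. *)
Definition morse_sets : set (set V) :=
  [set S | is_strong_component S /\ forall G, S = [set G] -> F G G].

Definition morse_ge (S T : morse_sets) : Prop :=
  exists G H, [/\ val S G, val T H & orbit_from_to G H].

(* The vertices left after n rounds of removing all stranded vertices. *)
Fixpoint trim_rounds (n : nat) : set V :=
  if n is m.+1 then
    [set G | [/\ trim_rounds m G,
                 exists2 H, trim_rounds m H & F H G &
                 exists2 H, trim_rounds m H & F G H]]
  else setT.

(* On a finite graph the decreasing sequence of the [trim_rounds n] is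
   eventually constant, with this intersection as final value. *)
Definition unstranded : set V := \bigcap_n trim_rounds n.

Definition trim : multimap unstranded := mm_restrict F unstranded.

Lemma orbit_from_to_refl G : orbit_from_to G G.
Proof. by exists 0%N, (fun=> G); split. Qed.

Lemma orbit_from_to_trans G H K :
  orbit_from_to G H -> orbit_from_to H K -> orbit_from_to G K.
Proof.
move=> [n [g [og g0 gn]]] [m [k [ok k0 km]]].
exists (n + m)%N, (fun i => if (i <= n)%N then g i else k (i - n)%N); split.
- move=> i ilt /=; case: (ltngtP i n) => [lin|lni|ein].
  + exact: og.
  + by rewrite subSn ?(ltnW lni)//; apply: ok; rewrite ltn_subLR// ltnW.
  + rewrite {i}ein in ilt *; rewrite gn -k0 subSnn; apply: ok.
    by move: ilt; rewrite -[X in (X < _)%N]addn0 ltn_add2l.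
- by rewrite leq0n.
- case: ifP => [le|_]; last by rewrite addKn.
  have m0 : m = 0%N by apply/eqP; rewrite -leqn0 -(leq_add2l n) addn0.
  by rewrite m0 addn0 gn -k0 -km m0.
Qed.

Lemma morse_setP (S : morse_sets) : is_strong_component (val S).
Proof. by have [] := set_valP S. Qed.

Lemma morse_set_connected (S : morse_sets) G H :
  val S G -> val S H -> orbit_from_to G H.
Proof.
have [K ->] := morse_setP S => -[_ GK] [KH _].
exact: orbit_from_to_trans GK KH.
Qed.

Lemma morse_ge_refl S : morse_ge S S.
Proof.
have [K SE] := morse_setP S; exists K, K; rewrite SE.
by split; [split; exact: orbit_from_to_refl..|exact: orbit_from_to_refl].
Qed.

Lemma morse_ge_trans S T U : morse_ge S T -> morse_ge T U -> morse_ge S U.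
Proof.
move=> [G [H [SG TH GH]]] [H' [K [TH' UK HK]]]; exists G, K; split => //.
apply: orbit_from_to_trans GH _; apply: orbit_from_to_trans HK.
exact: morse_set_connected TH TH'.
Qed.

Lemma morse_ge_antisym S T : morse_ge S T -> morse_ge T S -> S = T.
Proof.
move=> [G [H [SG TH GH]]] [H' [G' [TH' SG' HG']]].
have HG : orbit_from_to H G.
  apply: orbit_from_to_trans (morse_set_connected TH TH') _.
  exact: orbit_from_to_trans HG' (morse_set_connected SG' SG).
apply: val_inj; have [K SE] := morse_setP S; have [L TE] := morse_setP T.
move: SG TH; rewrite SE TE => -[KG GK] [LH HL].
have KL := orbit_from_to_trans KG (orbit_from_to_trans GH HL).
have LK := orbit_from_to_trans LH (orbit_from_to_trans HG GK).
apply/seteqP; split=> W /= [a b]; split.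
- exact: orbit_from_to_trans LK a.
- exact: orbit_from_to_trans b KL.
- exact: orbit_from_to_trans KL a.
- exact: orbit_from_to_trans b LK.
Qed.

End Orbits.
Arguments trim {V} F.

Record augmented_decomposition (V : Type) := AugmentedDecomposition {
  ad_sets : set (set V) ;
  ad_ge : ad_sets -> ad_sets -> Prop ;
  ad_ge_refl : forall S, ad_ge S S ;
  ad_ge_trans : forall S T U, ad_ge S T -> ad_ge T U -> ad_ge S U ;
  ad_ge_antisym : forall S T, ad_ge S T -> ad_ge T S -> S = T ;
  ad_map : forall S : ad_sets, multimap (val S) }.
Arguments ad_map {V} M S : rename.

Definition finest_augmented_morse_decomposition (V : Type) (F : multimap V) :
    augmented_decomposition V :=
  @AugmentedDecomposition V (morse_sets F) (@morse_ge V F)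
    (@morse_ge_refl V F) (@morse_ge_trans V F) (@morse_ge_antisym V F)
    (fun S => mm_restrict F (val S)).

Record grid_map_morphism (V V' : Type) (F : multimap V) (F' : multimap V') :=
  GridMapMorphism {
    gm_fun :> V -> V' ;
    gm_spec : forall G, gm_fun @` F G `<=` F' (gm_fun G) }.

Lemma gm_comp_spec (V V' V'' : Type) (F : multimap V) (F' : multimap V')
    (F'' : multimap V'') (h' : grid_map_morphism F' F'')
    (h : grid_map_morphism F F') (G : V) :
  (h' \o h) @` F G `<=` F'' ((h' \o h) G).
Proof.
move=> _ [H FGH <-]; apply: gm_spec; exists (h H) => //.
by apply: gm_spec; exists H.
Qed.

Definition gm_comp (V V' V'' : Type) (F : multimap V) (F' : multimap V')
    (F'' : multimap V'') (h' : grid_map_morphism F' F'')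
    (h : grid_map_morphism F F') : grid_map_morphism F F'' :=
  GridMapMorphism (@gm_comp_spec _ _ _ _ _ _ h' h).

Record ad_morphism (V V' : Type) (M : augmented_decomposition V)
    (M' : augmented_decomposition V') := ADMorphism {
  adm_bar : ad_sets M -> ad_sets M' ;
  adm_bar_mono : forall S T, ad_ge S T -> ad_ge (adm_bar S) (adm_bar T) ;
  adm_fun : forall S : ad_sets M,
    grid_map_morphism (ad_map M S) (ad_map M' (adm_bar S)) }.

Arguments adm_fun {V V' M M'} h S : rename.

Definition adm_comp (V V' V'' : Type) (M : augmented_decomposition V)
    (M' : augmented_decomposition V') (M'' : augmented_decomposition V'')
    (h' : ad_morphism M' M'') (h : ad_morphism M M') : ad_morphism M M'' :=
  @ADMorphism V V'' M M'' (adm_bar h' \o adm_bar h)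
    (fun S T ST => adm_bar_mono h' (adm_bar_mono h ST))
    (fun S => gm_comp (adm_fun h' (adm_bar h S)) (adm_fun h S)).

Record grid (X : topologicalType) := Grid {
  grid_cells :> set (set X) ;
  grid_finite : finite_set grid_cells ;
  grid_cell_neq0 : forall G, grid_cells G -> G !=set0 ;
  grid_cell_compact : forall G, grid_cells G -> compact G ;
  grid_cover : \bigcup_(G in grid_cells) G = [set: X] ;
  grid_cell_regular : forall G, grid_cells G -> G = closure G^° ;
  grid_cell_disjoint : forall G H, grid_cells G -> grid_cells H -> G <> H ->
    G `&` H^° = set0 }.

Definition grid_refines (X : topologicalType) (C C' : grid X) : Prop :=
  forall G, grid_cells C G -> exists2 G', grid_cells C' G' & G `<=` G'.

Definition is_sampled_data (X : Type) (f : X -> X) (D : set (X * X)) : Prop :=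
  finite_set D /\ forall p, D p -> p.2 = f p.1.

Definition sampled_multimap (X : topologicalType) (D : set (X * X))
    (C : grid X) : multimap C :=
  fun G => [set H | exists2 p, D p & val G p.1 /\ val H p.2].
Arguments sampled_multimap {X} D C.

Definition sampled_morse_decomposition (X : topologicalType)
    (D : set (X * X)) (C : grid X) :
    augmented_decomposition (unstranded (sampled_multimap D C)) :=
  finest_augmented_morse_decomposition (trim (sampled_multimap D C)).

(* Main.v *)
(* A cell of a fine grid is the closure of its nonempty interior, and the cells
   of a coarser grid do not meet the interiors of each other, so it lies in
   exactly one cell of the coarser grid.  The resulting map between cells is
   functorial by uniqueness and carries edges to edges, hence orbits to orbits;
   it therefore survives trimming and sends each Morse set into the strong
   component spanned by its image. *)
Require Import Defs.
From mathcomp Require Import all_boot all_order all_algebra.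
From mathcomp Require Import all_classical all_reals all_analysis.

Local Open Scope classical_set_scope.

Lemma grid_map_morphism_eq {V V' : Type} {F : multimap V} {F' : multimap V'}
    (h g : grid_map_morphism F F') : h =1 g -> h = g.
Proof.
case: h g => h hP [g gP] /= /funext hg; case: _ / hg in gP *.
by rewrite (Prop_irrelevance hP gP).
Qed.

(** The types of [adm_fun h S] and [adm_fun g S] depend on [adm_bar], so the fibre maps are compared
    through [val] in [V']; this avoids a transport along the equality of the bar maps. *)
Lemma ad_morphism_eq {V V' : Type} {M : augmented_decomposition V}
    {M' : augmented_decomposition V'} (h g : ad_morphism M M') :
  adm_bar h =1 adm_bar g ->
  (forall S G, val (adm_fun h S G) = val (adm_fun g S G)) -> h = g.
Proof.
case: h g => bh mh fh [bg mg fg] /= /funext hg.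
case: _ / hg in mg fg * => /= fE; rewrite (Prop_irrelevance mh mg).
congr ADMorphism; apply: functional_extensionality_dep => S.
by apply: grid_map_morphism_eq => G; apply: val_inj; exact: fE.
Qed.

(** * Edges inside Morse sets *)

Section MorseSets.
Context {V : Type} (F : multimap V).

Lemma orbit_step (G H : V) : F G H -> orbit_from_to F G H.
Proof.
move=> GH; exists 1%N, (fun i => if i is 0%N then G else H).
by split=> // -[].
Qed.

Lemma orbit_first_step (G H : V) : orbit_from_to F G H -> G <> H ->
  exists2 K, F G K & orbit_from_to F K H.
Proof.
move=> [[|n] [g [og <- <-]]] // _; exists (g 1%N); first exact: og.
by exists n, (fun i => g i.+1); split=> // i ilt; exact: og.
Qed.

Lemma strong_component_mutual (S : set V) (G H : V) : is_strong_component F S ->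
  S G -> (S H <-> orbit_from_to F G H /\ orbit_from_to F H G).
Proof.
move=> [K ->] /= [KG GK]; split=> -[a b]; split.
- exact: orbit_from_to_trans GK a.
- exact: orbit_from_to_trans b KG.
- exact: orbit_from_to_trans KG a.
- exact: orbit_from_to_trans b GK.
Qed.

Lemma strong_component_neq0 (S : set V) : is_strong_component F S -> S !=set0.
Proof.
by move=> [K ->]; exists K; split; exact: orbit_from_to_refl.
Qed.

(** A singleton carries its loop. Otherwise the first step of an orbit from [G] to another vertex
    [H] of [S] stays in [S], because the orbit goes on to [H] and [H] leads back to [G]. *)
Lemma morse_set_successor (S : set V) (G : V) : morse_sets F S -> S G ->
  exists2 K, S K & F G K.
Proof.
move=> [cS lS] SG; have [/lS GG|SnG] := pselect (S = [set G]).
  by exists G.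
have [H SH GH] : exists2 H, S H & G <> H.
  apply: contra_notP SnG => nH; apply/seteqP; split=> [H SH|H -> //] /=.
  by apply: contra_notP nH => HG; exists H => // GH; exact: HG.
have [a b] := (strong_component_mutual _ _ H cS SG).1 SH.
have [K GK KH] := orbit_first_step _ _ a GH; exists K => //.
apply/(strong_component_mutual _ _ _ cS SG); split; first exact: orbit_step.
exact: orbit_from_to_trans KH b.
Qed.

(** In a singleton component the given edge can only be the loop. *)
Lemma edge_morse_set (S : set V) (G K : V) : is_strong_component F S ->
  S G -> S K -> F G K -> morse_sets F S.
Proof.
move=> cS SG SK GK; split=> // L SL.
by move: SG SK GK; rewrite SL => -> ->.
Qed.

Lemma morse_set_eq (S T : morse_sets F) (G : V) : val S G -> val T G -> S = T.
Proof.
move=> SG TG; apply: morse_ge_antisym; exists G, G; split=> //;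
  exact: orbit_from_to_refl.
Qed.

End MorseSets.

(** * Functoriality of trimming and of Morse decompositions *)

Section GridMapMorphism.
Context {V V' : Type} {F : multimap V} {F' : multimap V'}.
Variable phi : grid_map_morphism F F'.

Lemma grid_map_edge (G H : V) : F G H -> F' (phi G) (phi H).
Proof. by move=> GH; apply: gm_spec; exists H. Qed.

Lemma grid_map_orbit (G H : V) :
  orbit_from_to F G H -> orbit_from_to F' (phi G) (phi H).
Proof.
move=> [n [g [og <- <-]]]; exists n, (phi \o g); split=> // i ilt.
exact/grid_map_edge/og.
Qed.

(** By induction on the round: the two neighbours that keep [G] map to neighbours that keep
    [phi G]. *)
Lemma grid_map_unstranded (G : V) : unstranded F G -> unstranded F' (phi G).
Proof.
move=> uG n _; have : trim_rounds F n G by exact: uG.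
elim: n G {uG} => //= n IH G [/IH tG [H tH HG] [K tK GK]]; split=> //.
- by exists (phi H); [exact: IH | exact: grid_map_edge].
- by exists (phi K); [exact: IH | exact: grid_map_edge].
Qed.

Definition trim_fun (G : unstranded F) : unstranded F' :=
  SigSub (mem_set (grid_map_unstranded _ (set_valP G))).

Lemma trim_fun_spec (G : unstranded F) :
  trim_fun @` trim F G `<=` trim F' (trim_fun G).
Proof. by move=> _ [H GH <-]; exact: grid_map_edge. Qed.

Definition trim_morphism : grid_map_morphism (trim F) (trim F') :=
  GridMapMorphism trim_fun_spec.

(** The direct image of [S] may be smaller than a component, so it is saturated under mutual
    reachability; no representative of [S] has to be chosen. *)
Definition image_component (S : set V) : set V' :=
  [set H | exists2 G, S G &
     orbit_from_to F' (phi G) H /\ orbit_from_to F' H (phi G)].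

Lemma image_componentP (S : set V) (G : V) : S G -> image_component S (phi G).
Proof. by move=> SG; exists G => //; split; exact: orbit_from_to_refl. Qed.

(** Images of vertices of [S] reach each other, so the saturation is the component of any one of
    them; an edge inside [S] maps to an edge that makes it nontrivial. *)
Lemma image_component_morse (S : set V) :
  morse_sets F S -> morse_sets F' (image_component S).
Proof.
move=> mS; have [cS _] := mS; have [G SG] := strong_component_neq0 _ _ cS.
have [K SK GK] := morse_set_successor _ _ _ mS SG.
apply: (edge_morse_set _ _ (phi G) (phi K)); last exact: grid_map_edge.
- exists (phi G); apply/seteqP; split=> H /=; last by exists G.
  move=> [L SL [LH HL]].
  have [GL LG] := (strong_component_mutual _ _ _ _ cS SG).1 SL.
  split; first exact: orbit_from_to_trans (grid_map_orbit _ _ GL) LH.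
  exact: orbit_from_to_trans HL (grid_map_orbit _ _ LG).
- exact: image_componentP.
- exact: image_componentP.
Qed.

Definition morse_bar (S : morse_sets F) : morse_sets F' :=
  SigSub (mem_set (image_component_morse _ (set_valP S))).

Lemma morse_bar_mono (S T : morse_sets F) :
  morse_ge S T -> morse_ge (morse_bar S) (morse_bar T).
Proof.
move=> [G [H [SG TH GH]]]; exists (phi G), (phi H).
by split; [exact: image_componentP | exact: image_componentP
          | exact: grid_map_orbit].
Qed.

Definition morse_fun (S : morse_sets F) (G : val S) : val (morse_bar S) :=
  SigSub (mem_set (image_componentP _ _ (set_valP G))).

Lemma morse_fun_spec (S : morse_sets F) (G : val S) :
  morse_fun S @` mm_restrict F (val S) G `<=`
  mm_restrict F' (val (morse_bar S)) (morse_fun S G).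
Proof. by move=> _ [H GH <-]; exact: grid_map_edge. Qed.

Definition morse_morphism :
    ad_morphism (finest_augmented_morse_decomposition F)
                (finest_augmented_morse_decomposition F') :=
  @ADMorphism V V' (finest_augmented_morse_decomposition F)
    (finest_augmented_morse_decomposition F') morse_bar morse_bar_mono
    (fun S => GridMapMorphism (morse_fun_spec S)).

End GridMapMorphism.

Lemma trim_morphism_comp {V V' V'' : Type} {F : multimap V} {F' : multimap V'}
    {F'' : multimap V''} (phi' : grid_map_morphism F' F'')
    (phi : grid_map_morphism F F') :
  gm_comp (trim_morphism phi') (trim_morphism phi) =
  trim_morphism (gm_comp phi' phi).
Proof. by apply: grid_map_morphism_eq => G; exact: val_inj. Qed.

Lemma morse_morphism_comp {V V' V'' : Type} {F : multimap V} {F' : multimap V'}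
    {F'' : multimap V''} (phi' : grid_map_morphism F' F'')
    (phi : grid_map_morphism F F') :
  adm_comp (morse_morphism phi') (morse_morphism phi) =
  morse_morphism (gm_comp phi' phi).
Proof.
(* The vertex maps agree by computation. For the bar maps, both Morse sets contain
   [phi' (phi G)]. *)
apply: ad_morphism_eq => // S /=.
have [G SG] := strong_component_neq0 _ _ (morse_setP S).
apply: (morse_set_eq _ _ _ (phi' (phi G))) => /=.
  exact/image_componentP/image_componentP.
exact: (image_componentP (gm_comp phi' phi)).
Qed.

(** * The cell map of a refinement *)

Section Grids.
Context {X : topologicalType}.

Lemma grid_cell_interior_neq0 (C : grid X) (G : set X) :
  grid_cells C G -> G° !=set0.
Proof.
move=> CG; apply/set0P/eqP => G0; have [x] := grid_cell_neq0 CG.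
by rewrite (grid_cell_regular CG) G0 closure0.
Qed.

(** An interior point of [G] lies in [H] and in the interior of [H'], which distinct cells
    exclude. *)
Lemma coarse_cell_unique (C C' : grid X) (G H H' : set X) :
  grid_cells C G -> grid_cells C' H -> grid_cells C' H' ->
  G `<=` H -> G `<=` H' -> H = H'.
Proof.
move=> CG CH CH' GH GH'; have [x Gx] := grid_cell_interior_neq0 _ _ CG.
apply: contrapT => /(grid_cell_disjoint CH CH') HH'.
suff : (H `&` H'°) x by rewrite HH'.
by split; [exact: GH _ (interior_subset Gx) | exact: interiorS GH' _ Gx].
Qed.

Lemma coarse_cell_ex (C C' : grid X) (r : grid_refines C C') (G : C) :
  exists G' : C', val G `<=` val G'.
Proof.
have [G' CG' GG'] := r _ (set_valP G).
by exists (SigSub (mem_set CG')).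
Qed.

Definition coarse_cell {C C' : grid X} (r : grid_refines C C') (G : C) : C' :=
  projT1 (cid (coarse_cell_ex _ _ r G)).

Lemma sub_coarse_cell {C C' : grid X} (r : grid_refines C C') (G : C) :
  val G `<=` val (coarse_cell r G).
Proof. by rewrite /coarse_cell; case: cid. Qed.

Lemma coarse_cell_comp {C C' C'' : grid X} (r : grid_refines C C')
    (r' : grid_refines C' C'') (r'' : grid_refines C C'') (G : C) :
  coarse_cell r' (coarse_cell r G) = coarse_cell r'' G.
Proof.
apply: val_inj; apply: (coarse_cell_unique C C'' (val G));
  [exact: set_valP|exact: set_valP|exact: set_valP| |exact: sub_coarse_cell].
by apply: subset_trans (sub_coarse_cell r G) _; exact: sub_coarse_cell.
Qed.

Context (D : set (X * X)).

(** The sample pair behind a fine edge also witnesses the coarse edge. *)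
Lemma coarse_cell_spec {C C' : grid X} (r : grid_refines C C') (G : C) :
  coarse_cell r @` sampled_multimap D C G `<=`
  sampled_multimap D C' (coarse_cell r G).
Proof.
move=> _ [H [p Dp [Gp Hp]] <-]; exists p => //.
by split; exact: sub_coarse_cell.
Qed.

Definition coarsening {C C' : grid X} (r : grid_refines C C') :
    grid_map_morphism (sampled_multimap D C) (sampled_multimap D C') :=
  GridMapMorphism (coarse_cell_spec r).

End Grids.

Theorem corollary7p4 (R : realType) (X : metricType R)
    (X_compact : compact [set: X]) (f : X -> X) (f_cont : continuous f)
    (D : set (X * X)) (D_sampled : is_sampled_data f D)
    (I : Type) (C : I -> grid X) :
  exists h : forall k1 k2 : I, grid_refines (C k1) (C k2) ->
      ad_morphism (sampled_morse_decomposition D (C k1))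
                  (sampled_morse_decomposition D (C k2)),
    forall (k1 k2 k3 : I)
      (r12 : grid_refines (C k1) (C k2)) (r23 : grid_refines (C k2) (C k3))
      (r13 : grid_refines (C k1) (C k3)),
      adm_comp (h k2 k3 r23) (h k1 k2 r12) = h k1 k3 r13.
Proof.
exists (fun k1 k2 r => morse_morphism (trim_morphism (coarsening D r))).
(* Both constructions respect composition, which leaves an equality of cell maps. *)
move=> k1 k2 k3 r12 r23 r13; rewrite morse_morphism_comp trim_morphism_comp.
congr (morse_morphism (trim_morphism _)); apply: grid_map_morphism_eq => G.
exact: coarse_cell_comp.
Qed.
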